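(* Let $\mathbf R$ be a fixed real closure of the rational function field $\mathbb R(X)$ (i.e. the real closure of $\mathbb R(X)$ with respect to some order). Then the space $M(\mathbf R(Y))$ of $\mathbb R$-places of the rational function field $\mathbf R(Y)$ is not metrizable.
   Context: An order $P$ of a field $K$ is identified with its set of positive elements. For an order $P$ of $K$ put $A(P)=\{a\in K:\exists q\in\mathbb Q^+,\ q\pm a\in P\}$, a valuation ring of $K$ with maximal ideal $I(P)=\{a\in K:\forall q\in\mathbb Q^+,\ q\pm a\in P\}$. The residue field $k(P)=A(P)/I(P)$ inherits an Archimedean order from $P$, so it embeds uniquely as an ordered field in $\mathbb R$. The $\mathbb R$-place $\lambda_K(P):K\to\mathbb R\cup\{\infty\}$ sends $a\in A(P)$ to its residue class viewed in $\mathbb R$, and $a\notin A(P)$ to $\infty$. $\mathcal X(K)$ is the set of all orders of $K$, with the topology having as subbase the Harrison sets $H_K(a)=\{P\in\mathcal X(K): a\in P\}$, $a\in K\setminus\{0\}$. $M(K)$ is the set of all $\mathbb R$-places of $K$, with the quotient topology from the surjection $\lambda_K:\mathcal X(K)\to M(K)$. *)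

(* Defs.v *)
From HB Require Import structures.
From mathcomp Require Import all_boot all_order all_algebra.
From mathcomp Require Import archimedean.
From mathcomp Require Import generic_quotient ring_quotient.
From mathcomp Require Import boolp classical_sets functions reals topology.

Set Implicit Arguments.
Unset Strict Implicit.
Unset Printing Implicit Defensive.

Import Order.TTheory GRing.Theory Num.Theory.

Local Open Scope classical_set_scope.
Local Open Scope ring_scope.

(* An order is identified with its set of (strictly) positive elements; that *)
(* pos and - pos are disjoint follows from posD and pos0. *)
Record field_order (K : fieldType) := FieldOrder {
  pos :> K -> Prop;
  pos0 : ~ pos 0;
  posD : forall x y, pos x -> pos y -> pos (x + y);
  posM : forall x y, pos x -> pos y -> pos (x * y);
  pos_total : forall x, x != 0 -> pos x \/ pos (- x)
}.

Lemma field_order_eq (K : fieldType) (P Q : field_order K) :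
  pos P = pos Q -> P = Q.
Proof.
by case: P Q => [p ? ? ? ?] [q ? ? ? ?] /= pq; subst q; congr FieldOrder;
  exact: Prop_irrelevance.
Qed.

Lemma pos_asym (K : fieldType) (P : field_order K) x : P x -> ~ P (- x).
Proof. by move=> Px /(posD Px); rewrite subrr; exact: pos0. Qed.

Definition ordered (K : fieldType) (P : field_order K) : Type := K.

Section Ordered.
Context (K : fieldType) (P : field_order K).
Local Notation KP := (ordered P).

HB.instance Definition _ := GRing.Field.copy KP K.

Let lt (x y : KP) : bool := `[< P (y - x) >].
Let le (x y : KP) : bool := (x == y) || lt x y.
Let norm (x : KP) : KP := if `[< P x >] then x else - x.

Let lt0_add x y : lt 0 x -> lt 0 y -> lt 0 (x + y).
Proof. by rewrite /lt !subr0 => /asboolP ? /asboolP ?; exact/asboolP/posD. Qed.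

Let lt0_mul x y : lt 0 x -> lt 0 y -> lt 0 (x * y).
Proof. by rewrite /lt !subr0 => /asboolP ? /asboolP ?; exact/asboolP/posM. Qed.

Let lt0_ngt0 x : lt 0 x -> ~~ lt x 0.
Proof.
by rewrite /lt subr0 sub0r => /asboolP ?; apply/negP => /asboolP; exact/pos_asym.
Qed.

Let sub_gt0 x y : lt 0 (y - x) = lt x y.
Proof. by rewrite /lt subr0. Qed.

Let lt0_total x : x != 0 -> lt 0 x || lt x 0.
Proof.
rewrite /lt subr0 sub0r => /(pos_total P) [?|?]; apply/orP; [left|right];
  exact/asboolP.
Qed.

Let normN x : norm (- x) = norm x.
Proof.
rewrite /norm opprK; have [->|x0] := eqVneq x 0; first by rewrite oppr0 !if_same.
case: asboolP => [nx|nnx]; case: asboolP => // px.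
  by case: (pos_asym px).
by case: (pos_total P x0).
Qed.

Let ge0_norm x : le 0 x -> norm x = x.
Proof.
by rewrite /norm /le /lt subr0 => /predU1P[<-|->//]; rewrite oppr0 if_same.
Qed.

HB.instance Definition _ := Num.IntegralDomain_isLtReal.Build KP
  lt0_add lt0_mul lt0_ngt0 sub_gt0 lt0_total normN ge0_norm (fun _ _ => erefl).

Lemma pos_gt0 (x : KP) : P x <-> 0 < x.
Proof.
rewrite -[0 < x]/(lt 0 x) /lt subr0; split=> [?|]; first exact/asboolP.
by move/asboolP.
Qed.

End Ordered.

Section ValuationRing.
Context (K : fieldType) (P : field_order K).
Local Notation KP := (ordered P).

(* An ordered field has characteristic 0, so ratr embeds rat in K. *)
Definition valuation_ring : {pred K} :=
  fun a => `[< exists2 q : rat, 0 < q & P (ratr q + a) /\ P (ratr q - a) >].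

Definition valuation_ideal : {pred K} :=
  fun a => `[< forall q : rat, 0 < q -> P (ratr q + a) /\ P (ratr q - a) >].

Lemma pos_norml (q : rat) (a : KP) :
  P (ratr q + a) /\ P (ratr q - a) <-> `|a| < ratr q.
Proof.
rewrite ltr_norml; split=> [[/pos_gt0 qa /pos_gt0 aq]|/andP[qa aq]].
  by rewrite -subr_gt0 opprK addrC qa -subr_gt0 aq.
split; apply/pos_gt0; last by rewrite subr_gt0.
by rewrite -[a in X in 0 < X]opprK subr_gt0 ltrNl.
Qed.

Lemma valuation_ringP (a : KP) :
  reflect (exists2 q : rat, 0 < q & `|a| < ratr q) (a \in valuation_ring).
Proof.
rewrite /valuation_ring unfold_in.
by apply: (iffP (asboolP _)) => -[q q0 /pos_norml aq]; exists q.
Qed.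

Lemma valuation_idealP (a : KP) :
  reflect (forall q : rat, 0 < q -> `|a| < ratr q) (a \in valuation_ideal).
Proof.
rewrite /valuation_ideal unfold_in.
by apply: (iffP (asboolP _)) => h q /h /pos_norml.
Qed.

Lemma valuation_ring_subring : subring_closed valuation_ring.
Proof.
split=> [|a b|a b].
- apply/(valuation_ringP (1 : KP)); exists 2 => //.
  by rewrite normr1 ratr_nat ltr1n.
- move=> /(valuation_ringP (a : KP))[p p0 ap] /(valuation_ringP (b : KP))[q q0 bq].
  apply/(valuation_ringP (a - b : KP)); exists (p + q); first exact: addr_gt0.
  by rewrite rmorphD (le_lt_trans (ler_normB _ _))// ltrD.
- move=> /(valuation_ringP (a : KP))[p p0 ap] /(valuation_ringP (b : KP))[q q0 bq].
  apply/(valuation_ringP (a * b : KP)); exists (p * q); first exact: mulr_gt0.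
  by rewrite rmorphM/= normrM ltr_pM.
Qed.

HB.instance Definition _ :=
  GRing.isSubringClosed.Build K valuation_ring valuation_ring_subring.

Record valuation_ring_of := ValuationRingOf {
  valuation_ring_val :> K; _ : valuation_ring_val \in valuation_ring }.

HB.instance Definition _ := [isSub for valuation_ring_val].
HB.instance Definition _ := [Choice of valuation_ring_of by <:].
HB.instance Definition _ :=
  [SubChoice_isSubComNzRing of valuation_ring_of by <:].

(* The maximal ideal, as a subset of the valuation ring. *)
Definition maximal_ideal : {pred valuation_ring_of} :=
  fun a => val a \in valuation_ideal.

Lemma maximal_idealP (a : valuation_ring_of) :
  reflect (forall q : rat, 0 < q -> `|val a : KP| < ratr q)
    (a \in maximal_ideal).
Proof. exact: valuation_idealP. Qed.

Lemma maximal_ideal_idealr : idealr_closed maximal_ideal.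
Proof.
split=> [||a u v].
- by apply/maximal_idealP => q q0; rewrite rmorph0 normr0 ltr0q.
- apply/maximal_idealP => /(_ 1 ltr01).
  by rewrite rmorph1 normr1 rmorph1 ltxx.
- move=> /maximal_idealP uI /maximal_idealP vI.
  apply/maximal_idealP => q q0; rewrite rmorphD rmorphM/=.
  have /(valuation_ringP (val a : KP))[p p0 ap] := valP a.
  have q20 : 0 < q / 2 by rewrite divr_gt0.
  rewrite (splitr q) rmorphD/= (le_lt_trans (ler_normD _ _))// ltrD ?vI//.
  rewrite normrM (lt_le_trans (ltr_pM _ _ ap (uI (q / 2 / p) _)))//.
    by rewrite divr_gt0.
  by rewrite -rmorphM/= mulrCA divff ?mulr1// gt_eqF.
Qed.

HB.instance Definition _ :=
  isIdealr.Build valuation_ring_of maximal_ideal maximal_ideal_idealr.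

Definition residue_field : Type := {ideal_quot maximal_ideal}.

HB.instance Definition _ := GRing.ComNzRing.on residue_field.
HB.instance Definition _ := Quotient.on residue_field.

Definition residue (a : valuation_ring_of) : residue_field :=
  \pi_residue_field%qT a.

HB.instance Definition _ := GRing.RMorphism.copy residue \pi_residue_field%qT.

Lemma residue_eq0 a : (residue a == 0) = (a \in maximal_ideal).
Proof.
rewrite -[in RHS](subr0 a) Quotient.idealrBE -[in LHS](rmorph0 residue).
exact: erefl.
Qed.

Lemma residue_surj x : exists a, residue a = x.
Proof. by exists (repr x); rewrite /residue reprK. Qed.

Let inv (x : residue_field) : residue_field :=
  if x == 0 then 0 else residue (insubd 0 (val (repr x))^-1).

Lemma valuation_ring_inv (a : valuation_ring_of) :
  a \notin maximal_ideal -> (val a)^-1 \in valuation_ring.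
Proof.
move=> /maximal_idealP/existsNP[q /not_implyP[q0 /negP]]; rewrite -leNgt => qa.
apply/(valuation_ringP ((val a)^-1 : KP)); exists (q^-1 + 1).
  by rewrite addr_gt0// invr_gt0.
rewrite normfV (@le_lt_trans _ _ (ratr q^-1))// ?ltr_rat ?ltrDl//.
rewrite fmorphV lef_pV2// ?posrE ?ltr0q//.
by rewrite (lt_le_trans _ qa)// ltr0q.
Qed.

Let mulVf x : x != 0 -> inv x * x = 1.
Proof.
move=> x0; rewrite /inv (negbTE x0).
have rI : repr x \notin maximal_ideal by rewrite -residue_eq0 /residue reprK.
have rx : residue (repr x) = x by rewrite /residue reprK.
rewrite -[in X in _ * X]rx -rmorphM -[RHS](rmorph1 residue); congr residue.
apply: val_inj; rewrite rmorphM/= val_insubd valuation_ring_inv// mulVf//.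
apply: contra rI => /eqP r0; apply/maximal_idealP => q q0.
by rewrite [val _]r0 normr0 ltr0q.
Qed.

Let invr0 : inv 0 = 0.
Proof. by rewrite /inv eqxx. Qed.

HB.instance Definition _ :=
  GRing.ComNzRing_isField.Build residue_field mulVf invr0.

(* The order induced by P: a residue class is positive if it is nonzero and *)
(* has a representative in P. *)
Definition residue_pos (x : residue_field) : Prop :=
  x != 0 /\ exists2 a, residue a = x & P (val a).

Lemma residue_posP a :
  residue_pos (residue a) <-> residue a != 0 /\ P (val a).
Proof.
split=> [[ra0 [b ba Pb]]|[? ?]]; last by split=> //; exists a.
split=> //; have a0 : val a != 0.
  by apply: contra ra0 => /eqP a0; rewrite (_ : a = 0) ?rmorph0//; exact: val_inj.
have [//|/pos_gt0 Na] := pos_total P a0; exfalso.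
move/pos_gt0: Pb => Pb; move: ra0; rewrite residue_eq0 => /maximal_idealP; apply.
move=> q q0; have : residue (b - a) == 0 by rewrite rmorphB/= ba subrr.
rewrite residue_eq0 => /maximal_idealP/(_ _ q0); apply: le_lt_trans.
rewrite rmorphB/= ltr0_norm -?oppr_gt0// gtr0_norm ?addr_gt0//.
by rewrite lerDr ltW.
Qed.

Let residue_pos0 : ~ residue_pos 0.
Proof. by case; rewrite eqxx. Qed.

Let residue_posD x y : residue_pos x -> residue_pos y -> residue_pos (x + y).
Proof.
have [[a <-] [b <-]] := (residue_surj x, residue_surj y).
move=> /residue_posP[a0 Pa] /residue_posP[b0 Pb]; rewrite -rmorphD.
apply/residue_posP; split; last by rewrite rmorphD; exact: posD.
apply: contra a0; rewrite !residue_eq0 => /maximal_idealP abI.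
apply/maximal_idealP => q /abI; apply: le_lt_trans.
move/pos_gt0: Pa => Pa; move/pos_gt0: Pb => Pb.
by rewrite rmorphD/= !gtr0_norm ?addr_gt0// lerDl ltW.
Qed.

Let residue_posM x y : residue_pos x -> residue_pos y -> residue_pos (x * y).
Proof.
have [[a <-] [b <-]] := (residue_surj x, residue_surj y).
move=> /residue_posP[a0 Pa] /residue_posP[b0 Pb]; rewrite -rmorphM.
apply/residue_posP; split; last by rewrite rmorphM; exact: posM.
by rewrite rmorphM mulf_neq0.
Qed.

Let residue_pos_total x : x != 0 -> residue_pos x \/ residue_pos (- x).
Proof.
have [a <-] := residue_surj x => x0.
have a0 : val a != 0.
  apply: contra x0 => /eqP a0; rewrite (_ : a = 0) ?rmorph0//; exact: val_inj.
have [Pa|Pa] := pos_total P a0; [left|right]; first exact/residue_posP.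
by rewrite -rmorphN; apply/residue_posP; rewrite !rmorphN oppr_eq0.
Qed.

Definition residue_order : field_order residue_field :=
  FieldOrder residue_pos0 residue_posD residue_posM residue_pos_total.

HB.instance Definition _ :=
  Num.RealField.copy residue_field (ordered residue_order).

Lemma residue_gt0 (a : valuation_ring_of) :
  0 < residue a <-> residue a != 0 /\ P (val a).
Proof.
by rewrite -[0 < _]/(0 < (residue a : ordered residue_order)) -pos_gt0
  -residue_posP.
Qed.

Lemma residue_le (a b : valuation_ring_of) :
  (val a : KP) <= val b -> residue a <= residue b.
Proof.
rewrite le_eqVlt => /predU1P[/val_inj->//|]; rewrite -subr_gt0 => ab.
rewrite -subr_ge0 -rmorphB le_eqVlt eq_sym; apply/orP.
have [|r0] := eqVneq (residue (b - a)) 0; [by left|right].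
by apply/residue_gt0; split=> //; apply/pos_gt0.
Qed.

Let residue_archimedean : Num.archimedean_axiom residue_field.
Proof.
move=> x; have [a ax] := residue_surj x.
have /(valuation_ringP (val a : KP))[q q0 aq] := valP a.
exists (Num.bound q).+1; apply: (@le_lt_trans _ _ (Num.bound q)%:R).
  have lq : `|val a : KP| < (Num.bound q)%:R.
    by rewrite (lt_trans aq)// -ratr_nat ltr_rat archi_boundP// ltW.
  move: lq; rewrite ltr_norml => /andP[al ar]; rewrite -ax ler_norml.
  rewrite -(rmorph_nat residue) -rmorphN; apply/andP; split;
    by apply: residue_le; rewrite ltW// ?rmorphN rmorph_nat.
by rewrite ltr_nat.
Qed.

HB.instance Definition _ :=
  Num.NumDomain_bounded_isArchimedean.Build residue_field residue_archimedean.

End ValuationRing.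

Section ArchimedeanEmbedding.
Context (k : archiRealFieldType) (R : realType).

Let cut (x : k) (y : R) := forall q : rat,
  (ratr q < x -> ratr q <= y) /\ (x < ratr q -> y <= ratr q).

Let rat_between (F : archiRealFieldType) (x y : F) :
  x < y -> exists q : rat, x < ratr q < y.
Proof. by move=> /rat_in_itvoo[q]; rewrite in_itv/=; exists q. Qed.

Let cut_le x y z : cut x y -> cut x z -> z <= y.
Proof.
move=> xy xz; rewrite leNgt; apply/negP => /[dup] yz.
move=> /rat_between[p /andP[yp /rat_between[q /andP[pq qz]]]].
rewrite ltr_rat in pq; have [xq|qx] := ltP x (ratr q).
  by have := (xz q).2 xq; rewrite leNgt qz.
have : ratr p <= y by apply: (xy p).1; rewrite (lt_le_trans _ qx)// ltr_rat.
by rewrite leNgt yp.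
Qed.

Let cut_uniq x y z : cut x y -> cut x z -> y = z.
Proof. by move=> xy xz; apply: le_anti; rewrite !(cut_le xy, cut_le xz). Qed.

Let cut_ex x : exists y, cut x y.
Proof.
have [p /andP[_ px]] : exists q : rat, x - 1 < ratr q < x.
  by apply: rat_between; rewrite ltrBlDr ltrDl.
have ubx q : x < ratr q ->
    ubound [set (ratr r : R) | r in [set r : rat | ratr r < x]] (ratr q).
  by move=> xq _ [r /= rx <-]; rewrite ler_rat -(ler_rat k) ltW// (lt_trans rx).
exists (sup [set (ratr r : R) | r in [set r : rat | ratr r < x]]) => q; split=> qx.
  apply: ub_le_sup; last by exists q.
  have [r /andP[xr _]] : exists q : rat, x < ratr q < x + 1.
    by apply: rat_between; rewrite ltrDl.
  by exists (ratr r); exact: ubx.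
by apply: ge_sup; [exists (ratr p), p|exact: ubx].
Qed.

Let cutr q : cut (ratr q) (ratr q).
Proof. by move=> p; rewrite !ltr_rat !ler_rat; split; exact: ltW. Qed.

Let cutD x1 x2 y1 y2 : cut x1 y1 -> cut x2 y2 -> cut (x1 + x2) (y1 + y2).
Proof.
move=> c1 c2 q; split=> [|].
  rewrite -ltrBlDr => /rat_between[p /andP[qp px]].
  rewrite -[q](subrK p) rmorphD/= addrC lerD ?(c1 _).1 ?(c2 _).1//.
  by rewrite rmorphB/= ltrBlDl -ltrBlDr.
rewrite -ltrBrDr => /rat_between[p /andP[xp pq]].
rewrite -[q](subrK p) rmorphD/= addrC lerD ?(c1 _).2 ?(c2 _).2//.
by rewrite rmorphB/= ltrBrDl -ltrBrDr.
Qed.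

Let cutN x y : cut x y -> cut (- x) (- y).
Proof.
move=> c q; have := c (- q); rewrite !rmorphN/= => -[c1 c2]; split => h.
  by rewrite lerNr c2// ltrNr.
by rewrite lerNl c1// ltrNl.
Qed.

Let cut_gt0 x y : 0 < x -> cut x y -> 0 < y.
Proof.
move=> /rat_between[q /andP[q0 qx]] c; rewrite ltr0q in q0.
by rewrite (lt_le_trans _ ((c q).1 qx))// ltr0q.
Qed.

Let cutM x1 x2 y1 y2 : 0 < x1 -> 0 < x2 ->
  cut x1 y1 -> cut x2 y2 -> cut (x1 * x2) (y1 * y2).
Proof.
move=> x10 x20 c1 c2 q; have y10 := cut_gt0 x10 c1; have y20 := cut_gt0 x20 c2.
split.
  have [q0|q0 qx] := leP q 0.
    by move=> _; rewrite (@le_trans _ _ 0) ?lerq0// mulr_ge0 ?ltW.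
  have /rat_between[p] : ratr q / x2 < x1 by rewrite ltr_pdivrMr.
  rewrite ltr_pdivrMr// => /andP[qp px]; have p0 : 0 < p.
    by rewrite -(ltr0q k) -(pmulr_lgt0 _ x20) (lt_trans _ qp)// ltr0q.
  have -> : ratr q = ratr p * ratr (q / p) :> R.
    by rewrite -rmorphM mulrCA divff ?mulr1// lt0r_neq0.
  apply: ler_pM; rewrite ?ler0q ?divr_ge0 ?(ltW p0) ?(ltW q0)//.
    exact: (c1 p).1.
  by apply: (c2 _).1; rewrite fmorph_div/= ltr_pdivrMr ?ltr0q// mulrC.
move=> xq; have q0 : 0 < q.
  by rewrite -(ltr0q k) (lt_trans _ xq)// mulr_gt0.
have /rat_between[p] : x1 < ratr q / x2 by rewrite ltr_pdivlMr.
rewrite (ltr_pdivlMr _ _ x20) => /andP[xp pq]; have p0 : 0 < p.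
  by rewrite -(ltr0q k); exact: lt_trans x10 xp.
have -> : ratr q = ratr p * ratr (q / p) :> R.
  by rewrite -rmorphM mulrCA divff ?mulr1// lt0r_neq0.
apply: ler_pM; rewrite ?(ltW y10) ?(ltW y20)//; first exact: (c1 p).2.
by apply: (c2 _).2; rewrite fmorph_div/= ltr_pdivlMr ?ltr0q// mulrC.
Qed.

Lemma archimedean_embedding_ex :
  exists f : {rmorphism k -> R}, {homo f : x y / x < y}.
Proof.
pose f x := sval (cid (cut_ex x)); have fP x : cut x (f x) by exact: svalP.
have f_zmod : zmod_morphism f.
  by move=> x y; apply: cut_uniq (fP _) (cutD (fP x) (cutN (fP y))).
have fN x : f (- x) = - f x by apply: cut_uniq (fP _) (cutN (fP x)).
have f0 : f 0 = 0 by rewrite -(subrr 0) f_zmod subrr.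
have f_monoid : monoid_morphism f.
  split=> [|x y]; first by have := cutr 1; rewrite !rmorph1; exact: cut_uniq.
  wlog x0 : x / 0 < x => [hw|].
    have [|/hw//|->] := ltgtP x 0; last by rewrite mul0r f0 mul0r.
    rewrite -oppr_gt0 => /hw; rewrite mulNr !fN mulNr; exact: oppr_inj.
  wlog y0 : y / 0 < y => [hw|].
    have [|/hw//|->] := ltgtP y 0; last by rewrite mulr0 f0 mulr0.
    rewrite -oppr_gt0 => /hw; rewrite mulrN !fN mulrN; exact: oppr_inj.
  exact: cut_uniq (fP _) (cutM x0 y0 (fP x) (fP y)).
pose fz := GRing.isZmodMorphism.Build _ _ f f_zmod.
pose fm := GRing.isMonoidMorphism.Build _ _ f f_monoid.
pose g : {rmorphism k -> R} := HB.pack f fz fm.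
exists g => x y xy; rewrite -subr_gt0 -rmorphB; apply: cut_gt0 (fP _).
by rewrite subr_gt0.
Qed.

Lemma archimedean_embedding_uniq (f g : {rmorphism k -> R}) :
  {homo f : x y / x < y} -> {homo g : x y / x < y} -> f =1 g.
Proof.
have homo_cut (h : {rmorphism k -> R}) : {homo h : x y / x < y} ->
    forall x, cut x (h x).
  by move=> hh x q; rewrite -!(fmorph_rat h); split=> /hh/ltW.
by move=> fh gh x; apply: cut_uniq (homo_cut f fh x) (homo_cut g gh x).
Qed.

Definition archimedean_embedding : {rmorphism k -> R} :=
  sval (cid archimedean_embedding_ex).

Lemma archimedean_embedding_lt : {homo archimedean_embedding : x y / x < y}.
Proof. exact: svalP (cid archimedean_embedding_ex). Qed.

End ArchimedeanEmbedding.

(* R-places are maps into R extended by infinity, which is encoded as None. *)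
Definition real_place (K : fieldType) (R : realType) (P : field_order K) :
    K -> option R :=
  fun a => omap (archimedean_embedding (residue_field P) R \o @residue K P)
             (insub a).

HB.instance Definition _ (K : fieldType) := gen_eqMixin (field_order K).
HB.instance Definition _ (K : fieldType) := gen_choiceMixin (field_order K).

Definition harrison (K : fieldType) (a : K) : set (field_order K) :=
  [set P | pos P a].

HB.instance Definition _ (K : fieldType) :=
  @isSubBaseTopological.Build (field_order K) (set (field_order K))
    [set H | exists2 a : K, a != 0 & H = harrison a] id.

Definition real_places (K : fieldType) (R : realType) : Type :=
  set_type (range (@real_place K R)).

Section RealPlaces.
Context (K : fieldType) (R : realType).

Definition to_real_places (P : field_order K) : real_places K R :=
  exist _ (real_place R P) (mem_set (imageT _ P)).

Let real_places_ex (m : real_places K R) : exists P, to_real_places P = m.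
Proof.
case: m => f fM; have [P _ Pf] := set_mem fM; exists P.
exact: val_inj.
Qed.

Let of_real_places (m : real_places K R) := sval (cid (real_places_ex m)).

Let of_real_placesK : cancel of_real_places to_real_places.
Proof. by move=> m; exact: svalP (cid (real_places_ex m)). Qed.

HB.instance Definition _ :=
  isQuotient.Build (field_order K) (real_places K R) of_real_placesK.

End RealPlaces.

Definition real_places_space (K : fieldType) (R : realType) : topologicalType :=
  quotient_topology (real_places K R).

(* Nonnegativity of d follows from the other axioms. *)
Definition metrizable (R : realType) (T : topologicalType) : Prop :=
  exists d : T -> T -> R,
    [/\ forall x, d x x = 0,
        forall x y, d x y = 0 -> x = y,
        forall x y, d x y = d y x,
        forall x y z, d x z <= d x y + d y z &
        forall U : set T, open U <-> forall x, U x ->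
          exists2 e, 0 < e & [set y | d x y < e] `<=` U].

Definition is_real_closure (k : fieldType) (P : field_order k) (F : rcfType)
    (iota : {rmorphism k -> F}) : Prop :=
  (forall a, pos P a <-> 0 < iota a) /\ forall x, algebraicOver iota x.

(* Main.v *)
(* The field F is non-Archimedean over R: some e > 0 is smaller than every
   positive real. For c in R take an order P_c of F(Y) with c < Y < c + e. The
   set of places finite at (Y - c) / e is open and contains the place of P_c,
   but not that of P_c' for c' <> c, since (c' - c) / e is infinite. As R is
   uncountable, a metric would make infinitely many of these places uniformly
   separated; but an ultralimit of the corresponding orders P_c is again an
   order, and its place is a cluster point of them. Orders of F(Y) are obtained
   as signs of rational functions along a nonprincipal ultrafilter on F. *)
Require Import Defs.
From mathcomp Require Import all_boot all_order all_algebra.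
From mathcomp Require Import boolp classical_sets cardinality.
From mathcomp Require Import generic_quotient finmap reals topology.
From mathcomp Require Import ereal lebesgue_measure.

Set Implicit Arguments.
Unset Strict Implicit.
Unset Printing Implicit Defensive.

Import Order.TTheory GRing.Theory Num.Theory.

Local Open Scope classical_set_scope.
Local Open Scope ring_scope.

(** * Ultrafilters and orders of rational function fields *)

Lemma infinite_ultrafilter T (A : set T) : infinite_set A ->
  exists G : set_system T,
    UltraFilter G /\ forall B, finite_set (A `\` B) -> G B.
Proof.
move=> Ainf; pose F : set_system T := [set B | finite_set (A `\` B)].
(* [F] is proper because [A] is infinite: removing the finite part of [A] outside [B] leaves a point
   of [B]. *)
suff /ultraFilterLemma[G [GU FG]] : ProperFilter F by exists G.
apply: Build_ProperFilter_ex => [B|].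
  rewrite /F/= => AB; have [x [Ax nABx]] : A `\` (A `\` B) !=set0.
    exact/infinite_setN0/infinite_setD.
  by exists x; apply: contrapT => nBx; exact: nABx.
split=> [|B C fB fC|B C BC]; rewrite /F/=.
- by rewrite setDT.
- by rewrite setDIr finite_setU.
- by apply: sub_finite_set; exact: setDS.
Qed.

Lemma infinite_inj_seq T (A : set T) (u : nat -> T) :
  injective u -> (forall n, A (u n)) -> infinite_set A.
Proof.
move=> uI uA fA; apply: infinite_nat; apply: (@sub_finite_set _ _ (u @^-1` A)).
  by move=> n _; exact: uA.
by apply: finite_preimage => // x y _ _; exact: uI.
Qed.

(* This is compactness of the space of orders: [Q] is the limit of [p] along *)
(* [G]. *)
Lemma ultralimit_order (K : fieldType) T (p : T -> field_order K)
    (G : set_system T) : UltraFilter G ->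
  exists Q : field_order K, forall a, Q a <-> G [set t | p t a].
Proof.
move=> GU; pose Q a := G [set t | p t a].
have Q0 : ~ Q 0 by move=> /filter_ex[t]; exact: pos0.
have QD x y : Q x -> Q y -> Q (x + y).
  by move=> Qx Qy; apply: filterS2 Qx Qy => t; exact: posD.
have QM x y : Q x -> Q y -> Q (x * y).
  by move=> Qx Qy; apply: filterS2 Qx Qy => t; exact: posM.
have Qt x : x != 0 -> Q x \/ Q (- x).
  move=> x0; have [Qx|nQx] := in_ultra_setVsetC [set t | p t x] GU.
    by left.
  by right; apply: filterS nQx => t ntx; have [] := pos_total (p t) x0.
by exists (FieldOrder Q0 QD QM Qt).
Qed.

Lemma fraction_quotient (A : idomainType) (f : {fraction A}) : f != 0 ->
  exists p q : A, [/\ p != 0, q != 0 & f = tofrac p / tofrac q].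
Proof.
elim/quotW: f => x; set f := (\pi%qT x : {fraction A}) => f0.
have fE : f = tofrac x.1 / tofrac x.2.
  apply: (canRL (mulfK _)); first by rewrite tofrac_eq0 denom_ratioP.
  rewrite /f; unlock tofrac; rewrite -[LHS]FracField.pi_mul; apply/eqmodP.
  rewrite /= FracField.equivfE /FracField.mulf.
  by rewrite !numden_Ratio ?mulf_neq0 ?oner_eq0 ?denom_ratioP// !mulr1 mulrC.
exists x.1, x.2; split; rewrite ?denom_ratioP//; apply: contra f0 => /eqP x0.
by rewrite fE x0 tofrac0 mul0r.
Qed.

(** The sign of a rational function is its sign at [G]-almost every point of [A]. It is defined
    because a nonzero polynomial has finitely many roots, which [G] avoids. *)
Lemma infinite_set_order (F : realFieldType) (A : set F) : infinite_set A ->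
  exists P : field_order {fraction {poly F}},
    forall p : {poly F}, (forall x, A x -> 0 < p.[x]) -> P (tofrac p).
Proof.
move=> /infinite_ultrafilter[G [GU GA]].
have Gpos (p : {poly F}) : p != 0 ->
    G [set x | 0 < p.[x]] \/ G [set x | 0 < (- p).[x]].
  move=> p0; have [?|Gnp] := in_ultra_setVsetC [set x | 0 < p.[x]] GU.
    by left.
  right; have Gnr : G [set x | ~~ root p x].
    apply: GA; apply: contrapT => /(@infinite_set_fset _ _ (size p))[B BA].
    rewrite leqNgt => /negP; apply; apply: max_poly_roots => //.
      by apply/allP => x /BA[_ /negP]; rewrite negbK.
    exact: fset_uniq.
  apply: filterS2 Gnp Gnr => x /= /negP; rewrite -leNgt hornerN oppr_gt0.
  by rewrite lt_neqAle => -> nr; rewrite andbT.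
(* Asking both terms to be positive loses nothing, since a fraction may be expanded by -1. *)
pose P (f : {fraction {poly F}}) := exists p q : {poly F},
  f = tofrac p / tofrac q /\ G [set x | 0 < p.[x] /\ 0 < q.[x]].
have Gneq0 (p : {poly F}) : G [set x | 0 < p.[x]] -> p != 0.
  move=> /filter_ex[x /= px]; apply: contraTneq px => ->.
  by rewrite horner0 ltxx.
have P0 : ~ P 0.
  case=> p [q [/esym/eqP]]; rewrite mulf_eq0 invr_eq0 !tofrac_eq0 => + Gpq.
  by rewrite !(negbTE (Gneq0 _ _))//; apply: filterS Gpq => x [].
have PD f g : P f -> P g -> P (f + g).
  move=> [p [q [-> pq]]] [r [s [-> rs]]].
  exists (p * s + r * q), (q * s); split.
    rewrite !(tofracD, tofracM) addf_div// tofrac_eq0 Gneq0//.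
      by apply: filterS pq => x [].
    by apply: filterS rs => x [].
  apply: filterS2 pq rs => x [? ?] [? ?]; rewrite /= !(hornerD, hornerM).
  by split; [apply: addr_gt0|]; exact: mulr_gt0.
have PM f g : P f -> P g -> P (f * g).
  move=> [p [q [-> pq]]] [r [s [-> rs]]]; exists (p * r), (q * s); split.
    by rewrite !tofracM mulf_div.
  by apply: filterS2 pq rs => x [? ?] [? ?]; rewrite /= !hornerM !mulr_gt0.
have Pt f : f != 0 -> P f \/ P (- f).
  move=> /fraction_quotient[p [q [p0 q0 ->]]].
  have [Gp|Gp] := Gpos _ p0; have [Gq|Gq] := Gpos _ q0; [left|right|right|left].
  - by exists p, q; split=> //; exact: filterI.
  - exists p, (- q); rewrite tofracN invrN mulrN; split=> //; exact: filterI.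
  - by exists (- p), q; rewrite tofracN mulNr; split=> //; exact: filterI.
  - exists (- p), (- q); rewrite !tofracN invrN mulrNN; split=> //.
    exact: filterI.
exists (FieldOrder P0 PD PM Pt) => p pA; exists p, 1; split.
  by rewrite tofrac1 divr1.
apply: GA; rewrite (_ : _ `\` _ = set0)//.
by rewrite -subset0 => x [/pA px]; apply; rewrite /= hornerC.
Qed.

(** A countable set is Lebesgue null, whereas the unit interval has measure 1. *)
Lemma realType_uncountable (R : realType) : ~ countable [set: R].
Proof.
move=> cR; have : countable (`[0, 1]%classic : set R).
  exact: (sub_countable (subset_card_le (@subsetT _ _)) cR).
move=> /countable_lebesgue_measure0; rewrite lebesgue_measure_itv/= lte01.
by rewrite oppr0 adde0 => /eqP; rewrite onee_eq0.
Qed.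


(** * Morphisms out of real closed fields, and infinitesimals *)

Section RealClosedMorphism.
Context (F : rcfType) (L : realDomainType) (f : {rmorphism F -> L}).

(** A positive element of a real closed field is a nonzero square, and so is its image. *)
Lemma rcf_rmorph_gt0 x : 0 < x -> 0 < f x.
Proof.
move=> x0; rewrite -(sqr_sqrtr (ltW x0)) rmorphXn exprn_even_gt0//=.
by rewrite fmorph_eq0 sqrtr_eq0 -ltNge.
Qed.

Lemma rcf_rmorph_lt x y : (f x < f y) = (x < y).
Proof.
apply/idP/idP=> [|xy]; last first.
  by rewrite -subr_gt0 -rmorphB rcf_rmorph_gt0 ?subr_gt0.
apply: contraTT; rewrite -!leNgt le_eqVlt => /predU1P[->//|yx].
by rewrite ltW// -subr_gt0 -rmorphB rcf_rmorph_gt0 ?subr_gt0.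
Qed.

Lemma rcf_rmorph_norm x : f `|x| = `|f x|.
Proof.
have [x0|x0|->] := ltgtP x 0; last by rewrite rmorph0 !normr0 rmorph0.
- by rewrite !ltr0_norm ?rmorphN// -(rmorph0 f) rcf_rmorph_lt.
- by rewrite !gtr0_norm ?rmorphN// rcf_rmorph_gt0.
Qed.

End RealClosedMorphism.

Section Infinitesimal.
Context (R : realType) (F : realFieldType).
Context (f : {rmorphism {fraction {poly R}} -> F}).

Let j : {rmorphism R -> F} := f \o (@tofrac {poly R} \o polyC).

(** Otherwise the image [t] of X would be bounded by reals and, by completeness of [R], equal to the
    supremum of the reals below it; but X is not constant. *)
Lemma infinitesimal_ex : exists2 e : F, 0 < e & forall a : R, 0 < a -> e < j a.
Proof.
apply: contrapT => noe.
have arch e : 0 < e -> exists2 a : R, 0 < a & j a <= e.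
  move=> e0; apply: contrapT => noa; apply: noe; exists e => // a a0.
  by rewrite ltNge; apply/negP => ?; apply: noa; exists a.
pose t := f (tofrac 'X).
have tj a : t != j a.
  apply/eqP => /fmorph_inj/eqP; rewrite tofrac_eq.
  move=> /eqP/(congr1 (fun p : {poly R} => p`_1)).
  by rewrite coefX coefC/= => /eqP; rewrite oner_eq0.
(* Inverting this bound gives a real above |t|, so that [S] is nonempty and bounded. *)
have [a a0] : exists2 a : R, 0 < a & j a <= (1 + `|t|)^-1.
  by apply: arch; rewrite invr_gt0 ltr_wpDr.
rewrite -lef_pV2 ?posrE ?invr_gt0 ?ltr_wpDr ?rcf_rmorph_gt0//.
rewrite invrK -fmorphV => ta.
have {ta} : `|t| < j a^-1 by rewrite (lt_le_trans _ ta)// ltrDr.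
rewrite ltr_norml -rmorphN => /andP[at_ ta].
pose S := [set x | j x < t].
have supS : has_sup S.
  split; [by exists (- a^-1)|exists a^-1 => x /= xt].
  by rewrite ltW// -(rcf_rmorph_lt j) (lt_trans xt).
(* A gap between [t] and the supremum would contain a positive real length [b], by which the
   supremum could be moved. *)
have [ts|ts|/eqP] := ltgtP t (j (sup S)); last by rewrite (negbTE (tj _)).
- have [b b0] : exists2 b, 0 < b & j b <= j (sup S) - t.
    by apply: arch; rewrite subr_gt0.
  rewrite lerBrDr -lerBrDl -rmorphB => tb.
  have [x xt] := sup_adherent b0 supS.
  by rewrite -(rcf_rmorph_lt j) ltNge ltW// (lt_le_trans xt).
- have [b b0] : exists2 b, 0 < b & j b <= t - j (sup S).
    by apply: arch; rewrite subr_gt0.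
  rewrite lerBrDl -rmorphD => tb.
  have : S (sup S + b).
    by rewrite /S/= lt_neqAle tb eq_sym tj.
  by move=> /(ub_le_sup supS.2); rewrite gerDl leNgt b0.
Qed.

End Infinitesimal.

(** * Topology of the spaces of orders and of places *)

Section RealPlacesSpace.
Context (K : fieldType) (R : realType).
Local Notation M := (real_places_space K R).

Lemma harrison_open (a : K) : open (harrison a).
Proof.
(* The subbase has only nonzero [a]; the Harrison set of 0 is empty. *)
have [->|a0] := eqVneq a 0.
  rewrite (_ : harrison 0 = set0); first exact: open0.
  by rewrite -subset0 => P /pos0.
exists [set harrison a]; last by rewrite bigcup_set1.
move=> _ ->; exists [fset harrison a]%fset.
  by move=> H; rewrite in_fset1 => /eqP ->; apply/mem_set; exists a.
by rewrite set_fset1 bigcap_set1.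
Qed.

(** It is enough to test Harrison sets, as their finite intersections form a base and [G] is closed
    under these. *)
Lemma cvg_orders T (p : T -> field_order K) (G : set_system T)
    (Q : field_order K) : Filter G ->
  (forall a, Q a -> G [set t | p t a]) -> p @ G --> Q.
Proof.
move=> GF QG A /=; rewrite nbhsE => -[_ [[B sB <-] [C BC CQ] BA]].
apply: (@filterS _ _ _ C); first by move=> P CP; apply: BA; exists C.
have /sB [D sD DC] := BC; rewrite -DC; apply: filter_bigI => E DE.
have /sD/set_mem[a _ Ea] := DE; rewrite nbhs_filterE Ea; apply: QG.
by move: CQ; rewrite -DC => /(_ _ DE); rewrite Ea.
Qed.

Definition to_space (P : field_order K) : M := \pi_M%qT P.

Lemma to_spaceE P : val (to_space P : real_places K R) = real_place R P.
Proof. by rewrite /to_space unlock. Qed.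

Lemma real_place_finite (P : field_order K) a :
  (real_place R P a != None) = (a \in valuation_ring P).
Proof. by rewrite /real_place; case: insubP => [? ->|/negbTE ->]. Qed.

Definition finite_at (a : K) : set M :=
  [set m | val (m : real_places K R) a != None].

Lemma finite_at_to_space a (P : field_order K) :
  finite_at a (to_space P) <-> a \in valuation_ring P.
Proof. by rewrite -real_place_finite -to_spaceE. Qed.

(** In the quotient topology it is the preimage among the orders that must be open, and the bound
    [q] writes it as a union of intersections of two Harrison sets. *)
Lemma finite_at_open a : open (finite_at a).
Proof.
rewrite /open/=/quotient_open (_ : _ @^-1` _ =
  \bigcup_(q in [set q : rat | 0 < q])
    (harrison (ratr q + a) `&` harrison (ratr q - a))).
  by apply: bigcup_open => q _; apply: openI; exact: harrison_open.
apply/seteqP; split=> P.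
  by move=> /(finite_at_to_space a P)/asboolP[q q0 Pq]; exists q.
by move=> [q q0 Pq]; apply/(finite_at_to_space a P)/asboolP; exists q.
Qed.

Lemma to_space_continuous : continuous to_space.
Proof. exact: pi_continuous. Qed.

End RealPlacesSpace.

(** * Membership in the valuation ring *)

(** Every order of [K] restricts to the unique order of [F], so finiteness of a constant is decided
    in [F]. *)
Lemma valuation_ring_rcf (K : fieldType) (P : field_order K) (F : rcfType)
    (f : {rmorphism F -> K}) x :
  f x \in valuation_ring P -> exists2 q : rat, 0 < q & `|x| < ratr q.
Proof.
move=> /(valuation_ringP (f x : ordered P))[q q0 fxq]; exists q => //.
pose g : {rmorphism F -> ordered P} := f.
by rewrite -(rcf_rmorph_lt g) rcf_rmorph_norm fmorph_rat.
Qed.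

Lemma valuation_ring_div (K : fieldType) (P : field_order K) (u v : K) :
  P u -> P (v - u) -> u / v \in valuation_ring P.
Proof.
move=> /pos_gt0 u0 /pos_gt0 vu; pose L := ordered P.
have uv : (u : L) < v by rewrite -subr_gt0.
have v0 : 0 < (v : L) := lt_trans u0 uv.
have uvE : u / v = (u : L) / (v : L) by [].
rewrite uvE; apply/(valuation_ringP ((u : L) / (v : L))); exists 1 => //.
by rewrite rmorph1 gtr0_norm ?divr_gt0// ltr_pdivrMr// mul1r.
Qed.

(** * Metrics against uncountable families of places *)

Lemma metric_ball_open (R : realType) (T : topologicalType) (d : T -> T -> R) :
  (forall x y z, d x z <= d x y + d y z) ->
  (forall U : set T, open U <-> forall x, U x ->
    exists2 e, 0 < e & [set y | d x y < e] `<=` U) ->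
  forall x e, open [set y | d x y < e].
Proof.
move=> dtri dopen x e; apply/dopen => y /= xy; exists (e - d x y).
  by rewrite subr_gt0.
by move=> z /=; rewrite ltrBrDl; apply: le_lt_trans.
Qed.

(** This serves to pick one radius that isolates infinitely many places. *)
Lemma uncountable_fiber_infinite (T : Type) (f : T -> nat) :
  ~ countable [set: T] -> exists n, infinite_set (f @^-1` [set n]).
Proof.
move=> Tunc; apply: contrapT => /forallNP fin; apply: Tunc.
rewrite (_ : setT = \bigcup_n (f @^-1` [set n])).
  apply: bigcup_countable => [|n _]; first exact: countableP.
  by apply: finite_set_countable; apply: contrapT; exact: fin.
by apply/seteqP; split=> // t _; exists (f t).
Qed.

(* The places of the [p t] form an uncountable relatively discrete family; by *)
(* compactness of the space of orders some infinite uniformly separated *)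
(* subfamily of it has a cluster point. *)
Lemma not_metrizable (K : fieldType) (R : realType) (T : choiceType)
    (p : T -> field_order K) (a : T -> K) :
  ~ countable [set: T] ->
  (forall t u, (a t \in valuation_ring (p u)) <-> t = u) ->
  ~ metrizable R (real_places_space K R).
Proof.
move=> Tunc apE [d [d0 _ dC dtri dopen]].
pose x t := to_space R (p t).
(* The open set [finite_at (a t)] contains [x t] and no other [x u], hence so does a small ball. *)
have Ue t : exists n : nat, forall u, d (x t) (x u) < n.+1%:R^-1 -> t = u.
  have [||e e0 eU] := (dopen (@finite_at K R (a t))).1 _ (x t).
  - exact: finite_at_open.
  - exact/finite_at_to_space/apE.
  have [n ne] : exists n : nat, n.+1%:R^-1 < e.
    exists (Num.bound e^-1); rewrite invf_plt ?posrE//.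
    by rewrite (lt_trans (archi_boundP _)) ?ltr_nat// invr_ge0 ltW.
  exists n => u tu; apply/apE/(finite_at_to_space R); apply: eU.
  exact: lt_trans ne.
have [n /infinite_ultrafilter[G [GU GA]]] :=
  uncountable_fiber_infinite (fun t => sval (cid (Ue t))) Tunc.
pose A := [set t | sval (cid (Ue t)) = n].
have An t : A t -> forall u, d (x t) (x u) < n.+1%:R^-1 -> t = u.
  by move=> <-; exact: svalP (cid (Ue t)).
have [Q GQ] := ultralimit_order p GU.
have xQ : x @ G --> to_space R Q.
  apply: (@cvg_comp _ _ _ p (to_space R) G (nbhs Q)).
    by apply: cvg_orders => b /GQ.
  exact: to_space_continuous.
(* With half the radius, any two points of the ball around the limit are closer than the
   separation. *)
have e0 : 0 < n.+1%:R^-1 / 2 :> R by rewrite divr_gt0 ?invr_gt0.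
have ballQ : nbhs (to_space R Q)
    [set y | d (to_space R Q) y < n.+1%:R^-1 / 2].
  by apply: open_nbhs_nbhs; split; [exact: metric_ball_open|rewrite /= d0].
have GB : G [set t | d (to_space R Q) (x t) < n.+1%:R^-1 / 2] := xQ _ ballQ.
have GAA : G A by apply: GA; rewrite setDv.
have [t [At tB]] := @filter_ex _ _ _ _ (filterI GAA GB).
(* [G] is nonprincipal, so the ball also contains some [x u] with [u] different from [t]. *)
have GCt : G [set~ t].
  apply: GA; apply: (@sub_finite_set _ _ [set t]) => //.
  by move=> u [_ /contrapT].
have [u [uB /= ut]] := @filter_ex _ _ _ _ (filterI GB GCt).
apply/ut/esym/(An _ At); rewrite (le_lt_trans (dtri _ (to_space R Q) _))//.
by rewrite (splitr n.+1%:R^-1) ltrD// dC.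
Qed.

Theorem corollary4p10 (R : realType) (P : field_order {fraction {poly R}})
    (F : rcfType) (iota : {rmorphism {fraction {poly R}} -> F})
    (RF : is_real_closure P iota) :
  ~ metrizable R (real_places_space {fraction {poly F}} R).
Proof.
have [e e0 ej] := infinitesimal_ex iota.
pose j : {rmorphism R -> F} := iota \o (@tofrac {poly R} \o polyC).
have /choice[p pP] (c : R) : exists p : field_order {fraction {poly F}},
    p (tofrac ('X - (j c)%:P)) /\ p (tofrac ((j c + e)%:P - 'X)).
  have [|p pP] := @infinite_set_order F [set x | j c < x < j c + e].
    (* Denominators start at 2 to stay strictly below the right endpoint. *)
    apply: (@infinite_inj_seq _ _ (fun n => j c + e / n.+2%:R)).
      move=> m n /addrI/(mulfI (lt0r_neq0 e0))/invr_inj/eqP.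
      by rewrite eqr_nat => /eqP[].
    move=> n /=; rewrite ltrDl ltrD2l divr_gt0//= ltr_pdivrMr//.
    by rewrite ltr_pMr// ltr1n.
  exists p; split; apply: pP => x /andP[cx xc].
    by rewrite hornerXsubC subr_gt0.
  by rewrite hornerD hornerN hornerC hornerX subr_gt0.
pose a (c : R) := tofrac ('X - (j c)%:P) / tofrac e%:P : {fraction {poly F}}.
apply: (@not_metrizable _ _ _ p a); first exact: realType_uncountable.
have ap c : a c \in valuation_ring (p c).
  have [cY Yc] := pP c; apply: valuation_ring_div => //.
  by rewrite -tofracB opprB addrA -polyCD [e + _]addrC.
move=> c c'; split=> [ac|<-//]; apply: contrapT => /eqP cc'.
(* The variable cancels in [a c - a c'], leaving a constant of [F] whose size is known. *)
have : tofrac (j (c' - c) / e)%:P \in valuation_ring (p c').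
  rewrite (_ : tofrac _ = a c - a c') ?rpredB//.
  have XB b b' : 'X - b%:P - ('X - b'%:P) = (b' - b)%:P :> {poly F}.
    by rewrite polyCB opprB [LHS]addrC addrA subrK.
  rewrite /a -mulrBl -tofracB XB; apply: (canRL (mulfK _)).
    by rewrite tofrac_eq0 polyC_eq0 gt_eqF.
  by rewrite -tofracM -polyCM divfK ?gt_eqF// rmorphB.
move=> /(valuation_ring_rcf (f := @tofrac {poly F} \o polyC))[q q0].
rewrite normrM normfV (gtr0_norm e0) ltr_pdivrMr// -rcf_rmorph_norm.
(* If [q] bounded this constant, [e] would exceed the positive real |c' - c|/q. *)
have := ej (`|c' - c| / ratr q).
rewrite divr_gt0 ?ltr0q ?normr_gt0 ?subr_eq0 1?eq_sym// => /(_ isT).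
rewrite -/(j _) rmorphM fmorphV fmorph_rat ltr_pdivlMr ?ltr0q// mulrC => + qe.
by move=> /(lt_trans qe); rewrite ltxx.
Qed.
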